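(* Let $F$ be a field of characteristic two, let $(A,\sigma)$ be a totally decomposable central simple $F$-algebra with anisotropic orthogonal involution, and let $S$ be an inseparable subalgebra of $(A,\sigma)$. Then $S=\mathrm{Alt}(A,\sigma)^+\oplus F=\mathrm{Sym}(A,\sigma)^+$, and $S$ is a maximal subfield of $A$. In particular, the inseparable subalgebra of $(A,\sigma)$ is uniquely determined.
   Context: Involutions are of the first kind. $(A,\sigma)$ is totally decomposable if it is isomorphic to a tensor product of quaternion $F$-algebras with involution. $\sigma$ is anisotropic if $\sigma(x)x=0$ implies $x=0$. $\mathrm{Alt}(A,\sigma)=\{\sigma(x)-x\mid x\in A\}$, $\mathrm{Alt}(A,\sigma)^+=\{x\in\mathrm{Alt}(A,\sigma)\mid x^2\in F\}$, $\mathrm{Sym}(A,\sigma)^+=\{x\in A\mid\sigma(x)=x,\ x^2\in F\}$. If $\deg_FA=2^n$, an inseparable subalgebra is a $2^n$-dimensional subalgebra $S\subseteq\mathrm{Sym}(A,\sigma)^+$ with $C_A(S)=S$, generated as an $F$-algebra by $n$ elements. *)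

(* Defs.v *)
From HB Require Import structures.
From mathcomp Require Import all_boot all_order all_algebra all_field.
Set Implicit Arguments. Unset Strict Implicit. Unset Printing Implicit Defensive.
Import GRing.Theory.
Local Open Scope ring_scope.


Section Defs.
Variables (F : fieldType) (A : falgType F).

Definition is_subalg (B : {vspace A}) : Prop :=
  ((1%R : A) \in B) /\ (B * B <= B)%VS.

Definition is_central_simple (B : {vspace A}) : Prop :=
  is_subalg B /\ 'Z(B)%VS = 1%VS /\
  forall I : {vspace A}, (I <= B)%VS -> (B * I <= I)%VS -> (I * B <= I)%VS ->
    I = 0%VS \/ I = B.

Definition is_quaternion_subalg (Q : {vspace A}) : Prop :=
  is_central_simple Q /\ \dim Q = 4%N.

Definition is_involution (sigma : A -> A) : Prop :=
  linear sigma /\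
  (forall x y, sigma (x * y) = sigma y * sigma x) /\
  (forall x, sigma (sigma x) = x).

Definition Alt (sigma : A -> A) (x : A) : Prop := exists y, x = sigma y - y.

(* characteristic 2 convention (KMRT Prop. 2.6): sigma is symplectic iff
   1 \in Alt(A,sigma); orthogonal otherwise. *)
Definition is_orthogonal_involution (sigma : A -> A) : Prop :=
  is_involution sigma /\ ~ Alt sigma (1%R : A).

Definition anisotropic (sigma : A -> A) : Prop :=
  forall x, sigma x * x = 0 -> x = 0.

Definition Alt_plus (sigma : A -> A) (x : A) : Prop :=
  Alt sigma x /\ x ^+ 2 \in 1%VS.

Definition Sym_plus (sigma : A -> A) (x : A) : Prop :=
  sigma x = x /\ x ^+ 2 \in 1%VS.

(* (A,sigma) totally decomposable: A is (internally) the tensor product of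
   m pairwise commuting sigma-stable quaternion subalgebras Q_1,...,Q_m. *)
Definition totally_decomposable (sigma : A -> A) : Prop :=
  exists (m : nat) (Q : 'I_m -> {vspace A}),
    (forall i, is_quaternion_subalg (Q i)) /\
    (forall i x, x \in Q i -> sigma x \in Q i) /\
    (forall i j, i != j -> (Q i <= 'C(Q j))%VS) /\
    (\big[@prodv F A/1%VS]_(i < m) Q i)%VS = fullv /\
    \dim (fullv : {vspace A}) = (4 ^ m)%N.

Definition has_degree (n : nat) : Prop := \dim (fullv : {vspace A}) = ((2 ^ n) ^ 2)%N.

Definition inseparable_subalg (sigma : A -> A) (n : nat) (S : {vspace A}) : Prop :=
  is_subalg S /\ \dim S = (2 ^ n)%N /\
  (forall x, x \in S -> Sym_plus sigma x) /\
  'C(S)%VS = S /\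
  exists xs : seq A, size xs = n /\ agenv <<xs>>%VS = S.

Definition is_subfield (S : {vspace A}) : Prop :=
  is_subalg S /\ (forall x y, x \in S -> y \in S -> x * y = y * x) /\
  (forall x, x \in S -> x != 0 -> exists2 y, y \in S & x * y = 1%R).

Definition is_maximal_subfield (S : {vspace A}) : Prop :=
  is_subfield S /\
  forall T : {vspace A}, is_subfield T -> (S <= T)%VS -> T = S.

End Defs.

(* Main.v *)
(* S is a field because sigma(x)x = x^2 for x in S and sigma is anisotropic.  Let
   t be a nonzero sigma-invariant trace on A.  Since C(S) = S, the quotient
   A/[S,A] is dual to S under t, hence one-dimensional over S, and q(u) =
   t(sigma(u)u) is additive in characteristic two, vanishes on [S,A], and satisfies
   q(us) = s^2 q(u).  As sigma is orthogonal, q is not identically zero, so q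
   vanishes exactly on [S,A].  If x is symmetric with x^2 in F, then q(xu) =
   x^2 q(u), so multiplication by x preserves [S,A]; thus t(x[s,v]) = 0 for all s
   and v, i.e. x commutes with S and lies in C(S) = S.  The forms
   u |-> t(s sigma(u)u), s in S, are all F-multiples of q by the same argument,
   and t(p sigma(u)u) = 0 for all u forces p into Alt: hence S lies in Alt + F. *)
Require Import Defs.
From HB Require Import structures.
From mathcomp Require Import all_boot all_order all_algebra all_field.
Set Implicit Arguments. Unset Strict Implicit. Unset Printing Implicit Defensive.
Import GRing.Theory.
Local Open Scope ring_scope.

(** * Central simple algebras: A (x) A^op as End_F(A), and trace functionals *)

Section CentralSimple.

Variables (F : fieldType) (A : falgType F).
Hypothesis csA : is_central_simple (fullv : {vspace A}).

Local Notation d := (\dim (fullv : {vspace A})).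
Local Notation e := (vbasis (fullv : {vspace A})).

Lemma coord_fullv (x : A) : x = \sum_(i < d) coord e i x *: e`_i.
Proof. by rewrite -coord_vbasis ?memvf. Qed.

Lemma mem_center (x : A) : (forall c, c * x = x * c) -> exists k : F, x = k%:A.
Proof.
move=> cx; have [_ [Z1 _]] := csA.
have: x \in 'Z(fullv : {vspace A})%VS.
  by rewrite memv_cap memvf; apply/centvP=> c _; rewrite cx.
by rewrite Z1 => /vlineP.
Qed.

(** The action on [u] of the tensor in A (x) A^op with coordinate matrix [C]. *)
Definition sandwich (u : A) (C : 'M[F]_d) : A :=
  \sum_i \sum_j C i j *: (e`_i * u * e`_j).

Lemma sandwich_is_linear u : linear (sandwich u).
Proof.
move=> k C D; rewrite /sandwich scaler_sumr -big_split; apply: eq_bigr => i _.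
rewrite scaler_sumr -big_split; apply: eq_bigr => j _ /=.
by rewrite !mxE scalerDl scalerA.
Qed.

HB.instance Definition _ u :=
  GRing.isLinear.Build F 'M[F]_d A *:%R (sandwich u) (sandwich_is_linear u).

Definition sandwichr (C : 'M[F]_d) (u : A) : A := sandwich u C.

Lemma sandwichr_is_linear C : linear (sandwichr C).
Proof.
move=> k u v; rewrite /sandwichr /sandwich scaler_sumr -big_split.
apply: eq_bigr => i _; rewrite scaler_sumr -big_split; apply: eq_bigr => j _ /=.
by rewrite mulrDr mulrDl scalerDr -scalerAr -scalerAl !scalerA mulrC.
Qed.

HB.instance Definition _ C :=
  GRing.isLinear.Build F A A *:%R (sandwichr C) (sandwichr_is_linear C).

Lemma mem_sandwich (a u b : A) : exists C, a * u * b = sandwich u C.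
Proof.
exists (\matrix_(i, j) (coord e i a * coord e j b)).
rewrite {1}(coord_fullv a) {1}(coord_fullv b) !mulr_suml; apply: eq_bigr => i _.
rewrite mulr_sumr; apply: eq_bigr => j _.
by rewrite mxE -!scalerAl -scalerAr scalerA.
Qed.

(** The two-sided ideal A u A is nonzero, so simplicity makes it contain 1. *)
Lemma sandwich_eq1 (u : A) : u != 0 -> exists C, sandwich u C = 1.
Proof.
move=> nz_u; have [_ [_ simpleA]] := csA.
pose I := limg (linfun (sandwich u)).
have memI a b : a * u * b \in I.
  have [C ->] := mem_sandwich a u b.
  by rewrite -[sandwich u C]lfunE memv_img ?memvf.
have IP w : w \in I -> exists C, w = sandwich u C.
  by case/memv_imgP=> C _ ->; exists C; rewrite lfunE.
have [||I0|II] := simpleA I (subvf _).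
- apply/prodvP=> c w _ /IP[C ->]; rewrite /sandwich mulr_sumr memv_suml // => i _.
  rewrite mulr_sumr memv_suml // => j _.
  by rewrite -scalerAr memvZ // mulrA mulrA memI.
- apply/prodvP=> w c /IP[C ->] _; rewrite /sandwich mulr_suml memv_suml // => i _.
  rewrite mulr_suml memv_suml // => j _.
  by rewrite -scalerAl memvZ // -(mulrA (_ * u)) memI.
- by have := memI 1 1; rewrite mul1r mulr1 I0 memv0 (negPf nz_u).
have /IP[C C1] : 1 \in I by rewrite II memvf.
by exists C.
Qed.

(* Artin-Whaples. Normalizing the first coefficient to 1 and commuting with an
   arbitrary element shortens the relation, so the other coefficients are
   central. *)
Lemma sandwich_free (b : seq A) (a : nat -> A) :
    free b -> (forall x, \sum_(i < size b) a i * x * b`_i = 0) ->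
  forall i, (i < size b)%N -> a i = 0.
Proof.
elim: b a => [|b0 b IHb] a //; rewrite free_cons => /andP[b0_notin fb] rel.
have [a0 | nz_a0] := eqVneq (a 0%N) 0.
  move=> [|i] //= lt_i; apply: (IHb (fun i => a i.+1)) => // x.
  by rewrite -[RHS](rel x) big_ord_recl a0 !mul0r add0r.
have [C C1] := sandwich_eq1 nz_a0.
(* Applying [C] to every coefficient keeps the relation, since [x] absorbs the right factors, and
   turns the first coefficient into 1. *)
pose a' i := sandwich (a i) C.
have rel' x : \sum_(i < (size b).+1) a' i * x * (b0 :: b)`_i = 0.
  have expand k : a' k * x * (b0 :: b)`_k =
      \sum_i \sum_j C i j *: (e`_i * (a k * (e`_j * x) * (b0 :: b)`_k)).
    rewrite /a' /sandwich !mulr_suml; apply: eq_bigr => i _.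
    by rewrite !mulr_suml; apply: eq_bigr => j _; rewrite -!scalerAl !mulrA.
  under eq_bigr do rewrite expand.
  rewrite exchange_big /= big1 // => i _; rewrite exchange_big /= big1 // => j _.
  by rewrite -scaler_sumr -mulr_sumr rel mulr0 scaler0.
have central i : (i < size b)%N -> exists k : F, a' i.+1 = k%:A.
  move=> lt_i; apply: mem_center => c; apply/subr0_eq.
  apply: (IHb (fun i => c * a' i.+1 - a' i.+1 * c)) lt_i => // x.
  (* Take [c] times the relation at [x] minus the relation at [c * x]: the first terms cancel
     because [a' 0] is 1. *)
  transitivity (c * \sum_(i < (size b).+1) a' i * x * (b0 :: b)`_i -
      \sum_(i < (size b).+1) a' i * (c * x) * (b0 :: b)`_i).
    rewrite !big_ord_recl /= -[a' 0%N]/(sandwich _ _) C1 !mul1r mulrDr mulr_sumr.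
    rewrite opprD addrACA !mulrA subrr add0r -sumrB; apply: eq_bigr => j _.
    by rewrite /bump /= add1n !mulrBl !mulrA.
  by rewrite !rel' mulr0 subrr.
have b0_in : b0 \in <<b>>%VS; last by rewrite b0_in in b0_notin.
have := rel' 1.
rewrite big_ord_recl /= -[a' 0%N]/(sandwich _ _) C1 !mul1r => /eqP.
rewrite addr_eq0 => /eqP->; rewrite memvN memv_suml // => i _.
have [k /= ->] := central i (ltn_ord i).
rewrite mulr1 -scalerAl mul1r memvZ // memv_span //; apply: mem_nth.
exact: ltn_ord.
Qed.

Lemma sandwich_basis_free (a : 'I_d -> A) :
  (forall x, \sum_i a i * x * e`_i = 0) -> forall i, a i = 0.
Proof.
move=> rel i; have fe : free e by apply: basis_free (vbasisP _).
(* Coefficients are extended by 0 beyond [d], as the induction on lists indexes them by [nat]. *)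
pose a' k := if insub k is Some j then a j else 0.
have a'E (j : 'I_d) : a' j = a j by rewrite /a' valK.
rewrite -a'E; apply: sandwich_free fe _ _ _ => [x|]; last by rewrite size_tuple.
by rewrite size_tuple -[RHS](rel x); apply: eq_bigr => j _; rewrite a'E.
Qed.

(* The functional h1 (x) h2 on A (x) A^op = End_F(A) is well defined. *)
Lemma sandwich_scalar (r : seq (A * A)) (h1 h2 : {scalar A}) :
    (forall x, \sum_(k <- r) k.1 * x * k.2 = 0) ->
  \sum_(k <- r) h1 k.1 * h2 k.2 = 0.
Proof.
move=> rel.
have coef0 : forall j, \sum_(k <- r) coord e j k.2 *: k.1 = 0.
  apply: sandwich_basis_free => x; rewrite -[RHS](rel x).
  under eq_bigr do rewrite !mulr_suml.
  rewrite exchange_big /=; apply: eq_bigr => k _ /=.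
  rewrite {2}(coord_fullv k.2) mulr_sumr; apply: eq_bigr => j _.
  by rewrite -!scalerAl scalerAr.
transitivity (\sum_(j < d) h2 e`_j * h1 (\sum_(k <- r) coord e j k.2 *: k.1)).
  under [RHS]eq_bigr do rewrite linear_sum mulr_sumr.
  rewrite exchange_big /=; apply: eq_bigr => k _ /=.
  rewrite {1}(coord_fullv k.2) linear_sum mulr_sumr; apply: eq_bigr => j _.
  by rewrite !linearZ /= mulrA mulrC; congr (_ * _); rewrite mulrC.
by rewrite big1 // => j _; rewrite coef0 linear0 mulr0.
Qed.

(** The map from A (x) A^op to End_F(A) is injective by [sandwich_basis_free], and both spaces have
    dimension d^2. *)
Lemma linear_sandwich (f : 'End(A)) : exists C, forall u, f u = sandwich u C.
Proof.
have lin_Phi : linear (fun C => linfun (sandwichr C)).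
  move=> k C D; apply/lfunP=> u; rewrite add_lfunE scale_lfunE !lfunE /=.
  by rewrite /sandwichr linearP.
pose Phi : {linear 'M[F]_d -> 'End(A)} := HB.pack (fun C => linfun (sandwichr C))
  (GRing.isLinear.Build F 'M[F]_d 'End(A) *:%R _ lin_Phi).
have PhiE C u : Phi C u = sandwich u C by rewrite lfunE.
have kerPhi : (lker (linfun Phi) == 0)%VS.
  rewrite -subv0; apply/subvP=> C; rewrite memv_ker lfunE memv0 => /eqP/lfunP C0.
  apply/eqP/matrixP=> i j; rewrite mxE.
  have rowC : forall l, \sum_k C k l *: e`_k = 0.
    apply: sandwich_basis_free => x.
    have := C0 x; rewrite PhiE zero_lfunE => E; rewrite -[RHS]E /sandwich exchange_big /=.
    apply: eq_bigr => l _; rewrite !mulr_suml; apply: eq_bigr => k _.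
    by rewrite -!scalerAl.
  have fe : free e by apply: basis_free (vbasisP _).
  by move/freeP: fe => /(_ (fun k => C k j) (rowC j)); apply.
have imPhi : limg (linfun Phi) = fullv.
  apply/eqP; rewrite eqEdim subvf limg_dim_eq; last by rewrite (eqP kerPhi) capv0.
  rewrite dimvf [X in (_ <= X)%N]dimvf dim_matrix (dimvf A).
  exact: leqnn.
have /memv_imgP[C _ ->] : f \in limg (linfun Phi) by rewrite imPhi memvf.
by exists C => u; rewrite lfunE PhiE.
Qed.

(** The trace of the endomorphism x |-> a x b. *)
Definition mulr_trace (b a : A) : F := \sum_(k < d) coord e k (a * e`_k * b).

Lemma mulr_trace_is_scalar b : scalar (mulr_trace b).
Proof.
move=> k x y; rewrite /mulr_trace mulr_sumr -big_split; apply: eq_bigr => i _ /=.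
by rewrite !mulrDl linearD -!scalerAl linearZ.
Qed.

HB.instance Definition _ b :=
  GRing.isLinear.Build F A F *%R (mulr_trace b) (mulr_trace_is_scalar b).

(** Right multiplication by [b] commutes with left multiplications, so it can be attached to either
    factor; the two matrix expansions then match. *)
Lemma mulr_traceC (b x y : A) : mulr_trace b (x * y) = mulr_trace b (y * x).
Proof.
have expand x1 y1 : mulr_trace b (x1 * y1) =
    \sum_(k < d) \sum_(l < d) coord e l (y1 * e`_k) * coord e k (x1 * e`_l * b).
  apply: eq_bigr => k _; rewrite -(mulrA x1) {1}(coord_fullv (y1 * e`_k)).
  rewrite mulr_sumr mulr_suml linear_sum; apply: eq_bigr => l _.
  by rewrite -scalerAr -scalerAl linearZ.
have expand2 x1 y1 : mulr_trace b (x1 * y1) =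
    \sum_(k < d) \sum_(l < d) coord e l (y1 * e`_k * b) * coord e k (x1 * e`_l).
  apply: eq_bigr => k _; rewrite -!mulrA (mulrA y1) {1}(coord_fullv (y1 * e`_k * b)).
  rewrite mulr_sumr linear_sum; apply: eq_bigr => l _.
  by rewrite -scalerAr linearZ.
rewrite expand expand2 exchange_big /=; apply: eq_bigr => k _; apply: eq_bigr => l _.
exact: mulrC.
Qed.

(* Left and right multiplications generate End_F(A), which contains maps of
   trace 1; hence a |-> tr(x |-> a x b) is nonzero for some b. *)
Lemma exists_trace : exists t : {scalar A},
  (forall x y : A, t (x * y) = t (y * x)) /\ exists x, t x != 0.
Proof.
have [i0 nz_1] : exists i0, coord e i0 (1 : A) != 0.
  apply/existsP; apply: contraT; rewrite negb_exists => /forallP coord0.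
  case/eqP: (oner_neq0 A); rewrite (coord_fullv 1) big1 // => i _.
  by have /negbNE/eqP-> := coord0 i; rewrite scale0r.
(* A rank-one map whose trace is [coord e i0 1], hence nonzero. *)
have lin_f : linear (fun u : A => coord e i0 u *: (1 : A)).
  by move=> k u v; rewrite linearP scalerDl scalerA.
pose f : {linear A -> A} := HB.pack (fun u : A => coord e i0 u *: (1 : A))
  (GRing.isLinear.Build F A A *:%R _ lin_f).
have [C fC] := linear_sandwich (linfun f).
have [/existsP[j /existsP[i nz_ij]] | all0] :=
    boolP [exists j : 'I_d, exists i : 'I_d, mulr_trace e`_j e`_i != 0].
  by exists (mulr_trace e`_j); split; [exact: mulr_traceC | exists e`_i].
case/eqP: nz_1.
transitivity (\sum_(k < d) coord e k (f e`_k)).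
  rewrite {1}(coord_fullv 1) linear_sum; apply: eq_bigr => k _ /=.
  by rewrite !linearZ /= mulrC.
transitivity (\sum_(i < d) \sum_(j < d) C i j * mulr_trace e`_j e`_i).
  under eq_bigr do rewrite -[f _]lfunE fC /sandwich linear_sum.
  rewrite exchange_big /=; apply: eq_bigr => i _.
  under eq_bigr do rewrite linear_sum.
  rewrite exchange_big /=; apply: eq_bigr => j _.
  by rewrite mulr_sumr; apply: eq_bigr => k _; rewrite linearZ.
rewrite big1 // => i _; rewrite big1 // => j _.
move: all0; rewrite negb_exists => /forallP/(_ j).
by rewrite negb_exists => /forallP/(_ i)/negbNE/eqP->; rewrite mulr0.
Qed.

(** If [y] is nonzero then 1 lies in A y A, and cyclicity makes [t] vanish on x A y A for every
    x. *)
Lemma trace_nondegenerate (t : {scalar A}) (y : A) :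
    (forall u v : A, t (u * v) = t (v * u)) -> (exists x, t x != 0) ->
  (forall v, t (y * v) = 0) -> y = 0.
Proof.
move=> tC [x nz_x] y0; apply/eqP; apply: contraNT nz_x => /sandwich_eq1[C C1].
rewrite -(mulr1 x) -C1 /sandwich mulr_sumr linear_sum big1 // => i _.
rewrite mulr_sumr linear_sum big1 // => j _ /=.
by rewrite -scalerAr linearZ /= tC -!mulrA tC -mulrA y0 mulr0.
Qed.

Lemma separating_functional (V : {vspace A}) (v : A) : v \notin V ->
  exists h : {scalar A}, (forall u, u \in V -> h u = 0) /\ h v = 1.
Proof.
move=> V'v; pose p u := u - projv V u.
have nz_pv : p v != 0.
  by apply: contraNneq V'v => /subr0_eq->; apply: memv_proj.
have [i nz_i] : exists i, coord e i (p v) != 0.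
  apply/existsP; apply: contraNT nz_pv; rewrite negb_exists => /forallP coord0.
  rewrite (coord_fullv (p v)) big1 // => i _.
  by have /negbNE/eqP-> := coord0 i; rewrite scale0r.
have lin_h : scalar (fun u => coord e i (p u) / coord e i (p v)).
  move=> k x y; rewrite /p linearP opprD addrACA -scalerBr linearP /=.
  by rewrite mulrDl mulrA.
exists (HB.pack_for {scalar A} (fun u => coord e i (p u) / coord e i (p v))
  (GRing.isLinear.Build F A F *%R _ lin_h)); split=> [u Vu|] /=.
  by rewrite /p projv_id // subrr linear0 mul0r.
by rewrite divff.
Qed.

End CentralSimple.

Section Involution.

Variables (F : fieldType) (A : falgType F).
Hypothesis char2 : 2 \in [pchar F].
Hypothesis csA : is_central_simple (fullv : {vspace A}).
Variable sigma : {linear A -> A}.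
Hypothesis sigmaM : forall x y : A, sigma (x * y) = sigma y * sigma x.
Hypothesis sigmaK : forall x, sigma (sigma x) = x.

Local Notation d := (\dim (fullv : {vspace A})).
Local Notation e := (vbasis (fullv : {vspace A})).

Lemma addvv2 (V : lmodType F) (v : V) : v + v = 0.
Proof. by rewrite -[v]scale1r -scalerDl (addrr_pchar2 char2) scale0r. Qed.

(** Symmetrize a trace [t] to [t] o [sigma] + [t]; if this is zero, [t] is already invariant in
    characteristic two. *)
Lemma exists_invariant_trace : exists t : {scalar A},
  [/\ forall x y, t (x * y) = t (y * x), forall x, t (sigma x) = t x
    & exists x, t x != 0].
Proof.
have [t [tC nz_t]] := exists_trace csA.
have [/existsP[i nz_i] | t_inv] := boolP [exists i : 'I_d, t (sigma e`_i) + t e`_i != 0].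
  have lin_u : scalar (fun x => t (sigma x) + t x).
    by move=> k x y; rewrite !linearP /= mulrDr addrACA.
  exists (HB.pack_for {scalar A} (fun x => t (sigma x) + t x)
    (GRing.isLinear.Build F A F *%R _ lin_u)); split=> [x y|x|] /=.
  - by rewrite !sigmaM (tC (sigma y)) (tC x).
  - by rewrite sigmaK addrC.
  - by exists e`_i.
exists t; split=> // x; rewrite (coord_fullv x) !linear_sum; apply: eq_bigr => i _.
rewrite !linearZ /=; congr (_ * _); move: t_inv; rewrite negb_exists.
move=> /forallP/(_ i)/negbNE/eqP/(canRL (addrK _)) ->.
by rewrite sub0r (oppr_pchar2 char2).
Qed.

Lemma sigmaZ (k : F) (x : A) : sigma (k *: x) = k *: sigma x.
Proof. exact: linearZ. Qed.

Variable t : {scalar A}.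
Hypothesis tC : forall x y : A, t (x * y) = t (y * x).
Hypothesis t_sigma : forall x, t (sigma x) = t x.
Hypothesis nz_t : exists x, t x != 0.

Lemma perp_neq0 (V : {vspace A}) : V != fullv ->
  exists2 y, y != 0 & forall v, v \in V -> t (y * v) = 0.
Proof.
move=> V'T; pose b := vbasis V.
have lin_f : linear (fun y => \row_(i < \dim V) t (y * b`_i)).
  move=> k x y; apply/rowP=> i.
  by rewrite !mxE mulrDl -scalerAl linearP.
pose f : {linear A -> 'rV[F]_(\dim V)} :=
  HB.pack (fun y => \row_(i < \dim V) t (y * b`_i)) (GRing.isLinear.Build F A _ *:%R _ lin_f).
have ltV : (\dim V < d)%N.
  rewrite ltnNge; apply: contra V'T => leV; by rewrite eqEdim subvf.
have nz_ker : lker (linfun f) != 0%VS.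
  rewrite -dimv_eq0 -lt0n -(ltn_add2r (\dim (limg (linfun f)))) add0n.
  rewrite -[lker _]capfv limg_ker_dim (leq_ltn_trans _ ltV) //.
  by rewrite (leq_trans (dimvS (subvf _))) // dimvf dim_matrix mul1r.
exists (vpick (lker (linfun f))); first by rewrite vpick0.
have := memv_pick (lker (linfun f)); rewrite memv_ker lfunE /= => /eqP/rowP y0 v Vv.
rewrite (coord_vbasis Vv) mulr_sumr linear_sum big1 // => i _ /=.
by rewrite -scalerAr linearZ /=; have := y0 i; rewrite !mxE => ->; rewrite mulr0.
Qed.

(** By nondegeneracy, y |-> t (sigma _ * y) identifies A with its dual; [h v] is the preimage of
    [g^~ v]. *)
Lemma represent_form (g : A -> A -> F) :
    (forall u, scalar (g u)) -> (forall v, scalar (g^~ v)) ->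
  exists h : 'End(A), forall u v, g u v = t (sigma u * h v).
Proof.
move=> lin_r lin_l.
pose gl v : {scalar A} := HB.pack (g^~ v) (GRing.isLinear.Build F A F *%R _ (lin_l v)).
have lin_f : linear (fun y => \row_(i < d) t (sigma e`_i * y)).
  by move=> k x y; apply/rowP=> i; rewrite !mxE mulrDr -scalerAr linearP.
pose f : {linear A -> 'rV[F]_d} :=
  HB.pack (fun y => \row_(i < d) t (sigma e`_i * y)) (GRing.isLinear.Build F A _ *:%R _ lin_f).
have kerf : (lker (linfun f) == 0)%VS.
  rewrite -subv0; apply/subvP=> y; rewrite memv_ker lfunE memv0 /= => /eqP/rowP y0.
  apply/eqP; apply: (trace_nondegenerate csA tC nz_t) => u.
  rewrite tC -(sigmaK u) (coord_fullv (sigma u)) linear_sum mulr_suml linear_sum.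
  rewrite big1 // => i _; rewrite linearZ /= -scalerAl linearZ /=.
  by have := y0 i; rewrite !mxE => ->; rewrite mulr0.
have imf : limg (linfun f) = fullv.
  apply/eqP; rewrite eqEdim subvf limg_dim_eq; last by rewrite (eqP kerf) capv0.
  by rewrite dimvf dim_matrix mul1r leqnn.
have lin_row : linear (fun v => \row_(i < d) g e`_i v).
  by move=> k x y; apply/rowP=> i; rewrite !mxE lin_r.
pose r : {linear A -> 'rV[F]_d} :=
  HB.pack (fun v => \row_(i < d) g e`_i v) (GRing.isLinear.Build F A _ *:%R _ lin_row).
exists ((linfun f)^-1 \o linfun r)%VF => u v; rewrite comp_lfunE.
set y := (_ ^-1)%VF _.
have fy : f y = r v by rewrite -[f y]lfunE limg_lfunVK ?imf ?memvf ?lfunE.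
rewrite -[g u v]/(gl v u) (coord_fullv u) !linear_sum mulr_suml linear_sum.
apply: eq_bigr => i _; rewrite !linearZ /= -scalerAl linearZ /=; congr (_ * _).
by have /rowP/(_ i) := fy; rewrite !mxE => ->.
Qed.

(** The bilinear form t (p * sigma u * v) is symmetric, so the cross terms cancel in characteristic
    two. *)
Lemma polarize (p u v : A) : sigma p = p ->
  t (p * sigma (u + v) * (u + v)) = t (p * sigma u * u) + t (p * sigma v * v).
Proof.
move=> sp; have cross : t (p * sigma v * u) = t (p * sigma u * v).
  by rewrite -t_sigma !sigmaM sigmaK sp mulrA tC mulrA.
rewrite !(linearD, mulrDr, mulrDl) /= cross.
by rewrite -addrA addKr_pchar2.
Qed.

(* If the form [t (p * sigma u * v)] is alternating, it equals g(u,v) + g(v,u)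
   for some bilinear g; writing g(u,v) = t (sigma u * h v) and h as an element
   of A (x) A^op turns this into [1 (x) p] being alternating in
   (A (x) A^op, sigma (x) sigma), which h1 (x) h2 forbids. *)
Lemma Alt_of_alternating (p : A) : sigma p = p -> ~ Alt sigma (1 : A) ->
  (forall u, t (p * sigma u * u) = 0) -> Alt sigma p.
Proof.
move=> sp Alt1 alt0; pose al := limg (linfun sigma - \1%VF).
have alE a : sigma a - a \in al.
  apply/memv_imgP; exists a; rewrite ?memvf //.
  by rewrite add_lfunE opp_lfunE lfunE id_lfunE.
have alP a : a \in al -> Alt sigma a.
  case/memv_imgP=> y _ ->; exists y.
  by rewrite add_lfunE opp_lfunE lfunE id_lfunE.
have [/alP // | al'p] := boolP (p \in al).
have al'1 : (1 : A) \notin al by apply/negP=> /alP.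
have [h1 [h1al h11]] := separating_functional al'1.
have [h2 [h2al h2p]] := separating_functional al'p.
have hs (h : {scalar A}) : (forall u, u \in al -> h u = 0) -> forall a, h (sigma a) = h a.
  move=> h0 a; apply/eqP; rewrite -subr_eq0 -linearB h0 //.
pose beta u v := t (p * sigma u * v).
have betaC u v : beta v u = beta u v.
  by rewrite /beta -t_sigma !sigmaM sigmaK sp mulrA tC mulrA.
(* The strictly upper triangular half of [beta]; its diagonal vanishes by [alt0]. *)
pose g u v := \sum_(i < d) \sum_(j < d | (i < j)%N)
  coord e i u * coord e j v * beta e`_i e`_j.
have lin_r u : scalar (g u).
  move=> k x y; rewrite /g mulr_sumr -big_split; apply: eq_bigr => i _ /=.
  rewrite mulr_sumr -big_split; apply: eq_bigr => j _ /=.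
  by rewrite linearP mulrDr mulrDl (mulrCA _ k) !mulrA.
have lin_l v : scalar (g^~ v).
  move=> k x y; rewrite /g mulr_sumr -big_split; apply: eq_bigr => i _ /=.
  rewrite mulr_sumr -big_split; apply: eq_bigr => j _ /=.
  by rewrite linearP !mulrDl !mulrA.
have [f gf] := represent_form lin_r lin_l.
have [C fC] := linear_sandwich csA f.
have gE u v : beta u v = g u v + g v u.
  have -> : beta u v = \sum_(i < d) \sum_(j < d) coord e i u * coord e j v * beta e`_i e`_j.
    rewrite /beta {1}(coord_fullv u) linear_sum mulr_sumr mulr_suml linear_sum.
    apply: eq_bigr => i _; rewrite {1}(coord_fullv v) mulr_sumr linear_sum.
    apply: eq_bigr => j _; rewrite linearZ /= -!scalerAr -scalerAl.
    by rewrite !linearZ /= mulrA (mulrC (coord e i u)).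
  have -> : g v u = \sum_(i < d) \sum_(j < d | (j < i)%N)
      coord e i u * coord e j v * beta e`_i e`_j.
    rewrite /g (exchange_big_dep xpredT) //=; apply: eq_bigr => i _.
    by apply: eq_bigr => j _; rewrite betaC (mulrC (coord e i u)).
  rewrite -big_split; apply: eq_bigr => i _ /=.
  rewrite (bigID (fun j : 'I_d => (i < j)%N)) /=; congr (_ + _).
  rewrite (bigD1 i) ?ltnn //= [X in _ * X](alt0 e`_i) mulr0 add0r.
  by apply: eq_bigl => j; rewrite -leqNgt ltn_neqAle andbC.
(* The equality [gE] read on operators: right multiplication by [p] is [C] plus its image under
   sigma (x) sigma. *)
have vp v : v * p = sandwich v C + \sum_i \sum_j C i j *: (sigma e`_i * v * sigma e`_j).
  apply/subr0_eq/(trace_nondegenerate csA tC nz_t) => u.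
  rewrite tC mulrBr linearB mulrDr linearD /=; apply/eqP; rewrite subr_eq0; apply/eqP.
  have -> : t (u * (v * p)) = beta (sigma u) v.
    by rewrite /beta sigmaK mulrA tC mulrA.
  rewrite gE !gf sigmaK fC; congr (_ + _).
  rewrite -t_sigma sigmaM sigmaK fC.
  have -> : sigma (sandwich (sigma u) C) =
      \sum_i \sum_j C i j *: (sigma e`_j * u * sigma e`_i).
    rewrite linear_sum; apply: eq_bigr => i _; rewrite linear_sum.
    by apply: eq_bigr => j _; rewrite sigmaZ !sigmaM sigmaK !mulrA.
  rewrite mulr_suml mulr_sumr !linear_sum; apply: eq_bigr => i _.
  rewrite mulr_suml mulr_sumr !linear_sum; apply: eq_bigr => j _.
  by rewrite -scalerAl -scalerAr !linearZ /= -!mulrA tC !mulrA.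
(* This tensor acts as zero. By [hs], h1 (x) h2 agrees on its last two blocks, which cancel, leaving
   h1(1) h2(p) = 1. *)
pose r := (- 1, p) :: [seq (C ij.1 ij.2 *: e`_ij.1, e`_ij.2) | ij : 'I_d * 'I_d]
  ++ [seq (C ij.1 ij.2 *: sigma e`_ij.1, sigma e`_ij.2) | ij : 'I_d * 'I_d].
have := @sandwich_scalar _ _ csA r h1 h2.
rewrite /r big_cons big_cat !big_image /= linearN h11 h2p mulr1.
rewrite [X in _ + (_ + X) = 0](eq_bigr (fun ij =>
  h1 (C ij.1 ij.2 *: e`_ij.1) * h2 e`_ij.2)); last first.
  by move=> ij _; rewrite !linearZ /= hs // hs.
rewrite (addrr_pchar2 char2) addr0 => H; case/eqP: (oner_neq0 F).
rewrite -[LHS](oppr_pchar2 char2) H // => x.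
rewrite big_cons big_cat !big_image /= mulN1r mulNr vp.
rewrite /sandwich !pair_big /=.
under [X in _ + (X + _)]eq_bigr do rewrite -!scalerAl.
under [X in _ + (_ + X)]eq_bigr do rewrite -!scalerAl.
by rewrite addNr.
Qed.

(** * The quadratic forms t (p * sigma u * u) for p in S *)

Hypothesis Alt1 : ~ Alt sigma (1 : A).
Hypothesis aniso : anisotropic sigma.
Variable S : {vspace A}.
Hypothesis subS : is_subalg S.
Hypothesis symS : forall x, x \in S -> Sym_plus sigma x.
Hypothesis centS : 'C(S)%VS = S.

Lemma memS_mul x y : x \in S -> y \in S -> x * y \in S.
Proof. by case: subS => _ /prodvP; apply. Qed.

Lemma memS_comm x y : x \in S -> y \in S -> x * y = y * x.
Proof. by rewrite -{1}centS => /centvP; apply. Qed.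

Lemma Sym_plus_sqr x : Sym_plus sigma x -> exists k : F, x * x = k%:A.
Proof. by case=> _ /vlineP. Qed.

Lemma Sym_plus_sqr_neq0 x :
  Sym_plus sigma x -> x != 0 -> exists2 k : F, k != 0 & x * x = k%:A.
Proof.
move=> x_sym nz_x; have [k xx] := Sym_plus_sqr x_sym; exists k => //.
apply: contraNneq nz_x => k0; apply/eqP/aniso.
by case: x_sym => -> _; rewrite xx k0 scale0r.
Qed.

Lemma form_mull (p x u : A) (k : F) : sigma x = x -> x * x = k%:A ->
  t (p * sigma (x * u) * (x * u)) = k * t (p * sigma u * u).
Proof.
move=> sx xx; rewrite sigmaM sx.
have -> : p * (sigma u * x) * (x * u) = k *: (p * sigma u * u).
  by rewrite !mulrA -(mulrA (p * sigma u)) xx -scalerAr mulr1 -scalerAl.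
by rewrite linearZ.
Qed.

Lemma form_mulr (p s w : A) (k : F) : p \in S -> s \in S -> s * s = k%:A ->
  t (p * sigma (w * s) * (w * s)) = k * t (p * sigma w * w).
Proof.
move=> Sp Ss ss; have [ss' _] := symS Ss; rewrite sigmaM ss' mulrA tC.
have -> : s * (p * (s * sigma w) * w) = k *: (p * sigma w * w).
  rewrite !mulrA -(mulrA s p s) (memS_comm Sp Ss) mulrA ss.
  by rewrite -!scalerAl mul1r.
by rewrite linearZ.
Qed.

(** As s^2 is scalar and s commutes with p, the two square terms agree, and so do the two cross
    terms by cyclicity. *)
Lemma form_commutator (p s v : A) : p \in S -> s \in S ->
  t (p * sigma (s * v - v * s) * (s * v - v * s)) = 0.
Proof.
move=> Sp Ss; have [s_sym _] := symS Ss.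
have [k ss] := Sym_plus_sqr (symS Ss).
rewrite linearB !sigmaM s_sym /=; set v' := sigma v.
rewrite !(mulrBr, mulrBl) !linearB /=.
have -> : t (p * (v' * s) * (s * v)) = k * t (p * v' * v).
  rewrite !mulrA -(mulrA (p * v')) ss -scalerAr mulr1 -scalerAl; exact: linearZ.
have -> : t (p * (s * v') * (v * s)) = k * t (p * v' * v).
  rewrite mulrA tC !mulrA -(mulrA s) (memS_comm Sp Ss) mulrA ss -!scalerAl mul1r.
  exact: linearZ.
have -> : t (p * (v' * s) * (v * s)) = t (p * (s * v') * (s * v)).
  by rewrite mulrA tC !mulrA (memS_comm Ss Sp).
by rewrite opprB (addrr_pchar2 char2).
Qed.

Definition commutators : {vspace A} :=
  (\sum_(i < \dim S) limg (amull (vbasis S)`_i - amulr (vbasis S)`_i))%VS.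

Lemma form_commutators (p u v : A) : p \in S -> u \in commutators ->
  t (p * sigma (u + v) * (u + v)) = t (p * sigma v * v).
Proof.
move=> Sp; have [sp _] := symS Sp.
suff form0 w : w \in commutators -> t (p * sigma w * w) = 0.
  by move=> /form0 u0; rewrite polarize // u0 add0r.
case/memv_sumP=> ws Uws ->.
apply: (big_ind (fun w => t (p * sigma w * w) = 0)) => [|x y x0 y0|i _].
- by rewrite mulr0 linear0.
- by rewrite polarize // x0 y0 addr0.
have /memv_imgP[z _ ->] := Uws i isT.
rewrite add_lfunE opp_lfunE !lfunE /=; apply: form_commutator => //.
by apply: vbasis_mem; apply: mem_nth; rewrite size_tuple.
Qed.

(* A / [S, A] is one-dimensional over the field S: the orthogonal of [S, A] for
   the trace form is C(S) = S. *)
Lemma commutators_decomposition (s0 w v : A) : s0 \in S -> t (s0 * w) != 0 ->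
  exists u s, [/\ u \in commutators, s \in S & v = u + w * s].
Proof.
move=> Ss0 nz_w; pose V := (commutators + amull w @: S)%VS.
suff VT : V = fullv.
  have /memv_addP[u Uu [ws /memv_imgP[s Ss ->] ->]] : v \in V by rewrite VT memvf.
  by exists u, s; rewrite lfunE.
apply/eqP; apply: contraNT nz_w => /perp_neq0[y nz_y Vy].
(* Orthogonality to [b, z] for all z means [y, b] = 0, so [y] centralizes S. *)
have Sy : y \in S.
  rewrite -centS; apply/centvP.
  suff: (S <= 'C[y])%VS by move/subvP=> SC x /SC/cent1vP.
  rewrite -(span_basis (vbasisP S)); apply/span_subvP=> b Sb.
  have [i b_i] : exists i : 'I_(\dim S), b = (vbasis S)`_i.
    have lt_i : (index b (vbasis S) < \dim S)%N.
      by rewrite -[X in (_ < X)%N](size_tuple (vbasis S)) index_mem.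
    by exists (Ordinal lt_i); rewrite nth_index.
  apply/cent1vP/esym/subr0_eq/(trace_nondegenerate csA tC nz_t) => z.
  have : b * z - z * b \in V.
    apply: (subvP (addvSl _ _)); apply: (subvP (sumv_sup i _ (subvv _))) => //.
    apply/memv_imgP; exists z; rewrite ?memvf //.
    by rewrite add_lfunE opp_lfunE !lfunE /= -b_i.
  move/Vy; rewrite mulrBr mulrBl !linearB /= => yz; rewrite -[RHS]yz !mulrA.
  by congr (_ - _); rewrite -(mulrA b) tC.
have [k nz_k yy] := Sym_plus_sqr_neq0 (symS Sy) nz_y.
(* Pairing this element with [y] gives y^2 t (s0 * w), where y^2 is a nonzero scalar. *)
have : w * (s0 * y) \in V.
  apply: (subvP (addvSr _ _)); apply/memv_imgP; exists (s0 * y); first exact: memS_mul.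
  by rewrite lfunE.
move/Vy; rewrite tC -!mulrA yy -!scalerAr mulr1 linearZ /= tC => /eqP.
by rewrite mulf_eq0 (negPf nz_k).
Qed.

(** If the form vanished at [w], it would vanish on [S, A] + w S = A, and [Alt_of_alternating] with
    p = 1 would contradict orthogonality. *)
Lemma form_neq0 (s w : A) : s \in S -> t (s * w) != 0 -> t (sigma w * w) != 0.
Proof.
move=> Ss nz_sw; apply/eqP=> w0; apply: Alt1; apply: Alt_of_alternating => //.
  by case: (symS (proj1 subS)).
move=> v; have [u [s' [Uu Ss' ->]]] := commutators_decomposition v Ss nz_sw.
have [k ss] := Sym_plus_sqr (symS Ss').
rewrite form_commutators ?(proj1 subS) // (form_mulr _ (proj1 subS) Ss' ss).
by rewrite mul1r w0 mulr0.
Qed.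

Lemma Sym_plus_mem x : Sym_plus sigma x -> x \in S.
Proof.
move=> x_sym; rewrite -centS; apply/centvP=> s Ss.
apply/subr0_eq/(trace_nondegenerate csA tC nz_t) => v.
have [k xx] := Sym_plus_sqr x_sym; have [sx _] := x_sym.
have S1 := proj1 subS.
have form0 : t (sigma (x * (s * v - v * s)) * (x * (s * v - v * s))) = 0.
  rewrite -[sigma _]mul1r (form_mull _ _ sx xx).
  by rewrite form_commutator // mulr0.
(* Contrapositive of [form_neq0]: an element on which the form vanishes has trace 0. *)
have : t (1 * (x * (s * v - v * s))) = 0.
  by apply/eqP; apply: contraTT (introT eqP form0) => /(form_neq0 S1).
rewrite mul1r mulrBr mulrBl !linearB /= => E; rewrite -[RHS]E !mulrA.
by congr (_ - _); rewrite -(mulrA s) tC.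
Qed.

(* On A = [S, A] + w S the forms t (p * sigma v * v), p in S, are all
   proportional over F to the one with p = 1. *)
Lemma mem_Alt_add_scalar s : s \in S -> exists c : F, Alt sigma (s - c%:A).
Proof.
move=> Ss; have [w nz_w] := nz_t; have S1 := proj1 subS.
have nz_1w : t (1 * w) != 0 by rewrite mul1r.
have nz_q := form_neq0 S1 nz_1w.
(* The ratio of the two forms at [w], so that the form of s - c vanishes there and hence on w S. *)
exists (t (s * sigma w * w) / t (sigma w * w)); set c := _ / _.
have Sp : s - c%:A \in S by rewrite memvB ?memvZ.
apply: Alt_of_alternating => // [|v]; first by case: (symS Sp).
have [u [s' [Uu Ss' ->]]] := commutators_decomposition v S1 nz_1w.
have [k ss] := Sym_plus_sqr (symS Ss').
rewrite form_commutators // (form_mulr _ Sp Ss' ss) !mulrBl linearB /=.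
rewrite -!scalerAl mul1r linearZ /= /c divfK // subrr mulr0 //.
Qed.

End Involution.

(** * Description, maximality and uniqueness of S *)

Theorem theorem3p5 (F : fieldType) (A : falgType F) (sigma : A -> A) (n : nat)
    (S : {vspace A}) :
  (2 \in [pchar F])%N ->
  is_central_simple (fullv : {vspace A}) ->
  is_orthogonal_involution sigma ->
  totally_decomposable sigma ->
  anisotropic sigma ->
  has_degree A n ->
  inseparable_subalg sigma n S ->
  [/\ (forall x, x \in S <-> exists a c, Alt_plus sigma a /\ c \in 1%VS /\ x = a + c),
      (forall x, Alt_plus sigma x -> x \in 1%VS -> x = 0),
      (forall x, x \in S <-> Sym_plus sigma x),
      is_maximal_subfield S &
      (forall S' : {vspace A}, inseparable_subalg sigma n S' -> S' = S)].
Proof.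
move=> char2 csA [[lin_s [sM sK]] Alt1] _ aniso _ insepS.
pose sl : {linear A -> A} := HB.pack sigma (GRing.isLinear.Build F A A *:%R sigma lin_s).
have [t [tC ts nz_t]] := exists_invariant_trace char2 csA (sigma := sl) sM sK.
have SymE S1 : inseparable_subalg sigma n S1 -> forall x, x \in S1 <-> Sym_plus sigma x.
  case=> subS1 [_ [symS1 [centS1 _]]] x; split; first exact: symS1.
  exact: (Sym_plus_mem char2 csA (sigma := sl) sM sK tC ts nz_t Alt1 aniso subS1 symS1 centS1).
have SE := SymE S insepS; have [subS [_ [symS [centS _]]]] := insepS.
have S_scalar x : x \in 1%VS -> x \in S.
  by case/vlineP=> k ->; rewrite memvZ // (proj1 subS).
have Alt_sym x : Alt sigma x -> sigma x = x.
  case=> y ->; rewrite -[sigma _]/(sl _) linearB /= sK.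
  by apply/subr0_eq; rewrite opprB (addvv2 char2).
split.
- move=> x; split=> [Sx | [a [c [[Alt_a sq_a] [Fc ->]]]]]; last first.
    apply: memvD; last exact: S_scalar.
    by apply/SE; split; first exact: Alt_sym.
  have [c Alt_c] := mem_Alt_add_scalar char2 csA (sigma := sl) sM sK tC ts nz_t
    Alt1 aniso subS symS centS Sx.
  exists (x - c%:A), c%:A; split; last by rewrite subrK memvZ ?memv_line.
  split=> //; apply: (proj2 (symS _ _)); rewrite memvB // S_scalar //.
  by rewrite memvZ ?memv_line.
- move=> x [Alt_x _] /vlineP[k x_k]; rewrite x_k; case: (eqVneq k 0) => [->|nz_k].
    by rewrite scale0r.
  (* A nonzero scalar in Alt would put 1 in Alt after rescaling. *)
  case: Alt1; case: Alt_x => y; rewrite x_k => y_k; exists (k^-1 *: y).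
  by rewrite -[sigma _]/(sl _) linearZ -scalerBr /= -y_k scalerA mulVf ?scale1r.
- exact: SE.
- split.
    split=> //; split=> [x y Sx Sy | x Sx nz_x].
      by move: Sx; rewrite -{1}centS => /centvP; apply.
    have [k nz_k xx] := Sym_plus_sqr_neq0 aniso (sigma := sl) (symS _ Sx) nz_x.
    exists (k^-1 *: x); first by rewrite memvZ.
    by rewrite -scalerAr xx scalerA mulVf ?scale1r.
  (* A commutative [T] containing S lies in C(S) = S. *)
  move=> T [_ [commT _]] sST; apply/eqP; rewrite eqEsubv sST andbT.
  rewrite -centS; apply/subvP=> x Tx; apply/centvP=> s Ss.
  by apply: commT => //; apply: (subvP sST).
- move=> S' /SymE S'E; apply/vspaceP=> x; apply/idP/idP.
    by move/S'E/SE.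
  by move/SE/S'E.
Qed.
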